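(* Let $(\mathcal A,\mathfrak g,h)$ be a (left) hermitian calculus. If there exists a Levi-Civita connection with respect to $h$ on $\Omega^1_{\mathfrak g}$, then $(\mathcal A,\mathfrak g,h)$ is weakly symmetric, i.e. its symmetry form $\rho\in\bar\Omega^2_{\mathfrak g}$ satisfies $d\rho=0$.
   Context: Setting. $\mathcal A$ is a unital associative $*$-algebra over $\mathbb C$ with center $Z(\mathcal A)$. $\mathrm{Der}(\mathcal A)$ is the complex Lie algebra of derivations of $\mathcal A$, with $(z\partial)(a)=z\,\partial(a)$ for $z\in Z(\mathcal A)$ and $\partial^*(a)=\partial(a^* )^*$. $\mathfrak g\subseteq\mathrm{Der}(\mathcal A)$ is a complex Lie subalgebra closed under $*$ (not necessarily a $Z(\mathcal A)$-submodule). Forms. $\bar\Omega^k_{\mathfrak g}$ is the set of alternating multiadditive maps $\omega:\mathfrak g^k\to\mathcal A$ such that $\omega(z\partial,\partial_2,\dots,\partial_k)=z\,\omega(\partial,\partial_2,\dots,\partial_k)$ whenever $z\in Z(\mathcal A)$, $\partial\in\mathfrak g$ and $z\partial\in\mathfrak g$; $\bar\Omega^0_{\mathfrak g}=\mathcal A$. It is an $\mathcal A$-bimodule by $(a\omega b)(\cdot)=a\,\omega(\cdot)\,b$. The exterior derivative is $da(\partial)=\partial(a)$ for $a\in\mathcal A$ and, for $\omega\in\bar\Omega^k_{\mathfrak g}$, $k\ge1$, $$d\omega(\partial_0,\dots,\partial_k)=\sum_{i}(-1)^i\partial_i\big(\omega(\partial_0,\dots,\hat\partial_i,\dots,\partial_k)\big)+\sum_{i<j}(-1)^{i+j}\omega([\partial_i,\partial_j],\partial_0,\dots,\hat\partial_i,\dots,\hat\partial_j,\dots,\partial_k).$$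 $\Omega^1_{\mathfrak g}\subseteq\bar\Omega^1_{\mathfrak g}$ is the sub-bimodule of finite sums of elements $a_0\,da_1$, $a_0,a_1\in\mathcal A$. Connections. A left $\mathfrak g$-connection on a left $\mathcal A$-module $M$ is a map $\nabla:M\times\mathfrak g\to M$, $(m,\partial)\mapsto\nabla_\partial m$, additive in both arguments, with $\nabla_\partial(am)=a\nabla_\partial m+(\partial a)m$ for $a\in\mathcal A$, and $\nabla_{z\partial}m=z\nabla_\partial m$ for $z\in Z(\mathcal A)$ with $z\partial\in\mathfrak g$. $(\mathcal A,\mathfrak g)$ is a (left) derivation based calculus if there exists a left $\mathfrak g$-connection on $\Omega^1_{\mathfrak g}$. Hermitian forms. A left hermitian form on a left $\mathcal A$-module $M$ is a map $h:M\times M\to\mathcal A$, additive in the first argument, with $h(am_1,m_2)=a\,h(m_1,m_2)$ and $h(m_1,m_2)^*=h(m_2,m_1)$. Let $M^*$ be the dual of the left module $M$ (left $\mathcal A$-linear maps $M\to\mathcal A$), a right module by $(\phi a)(m)=\phi(m)a$. $h$ is invertible if $\hat h:M\to M^*$, $\hat h(m_1)(m_2)=h(m_2,m_1)$, is a bijection; then $h^{-1}:M^*\times M^*\to\mathcal A$ is defined by $h^{-1}(\phi_1,\phi_2)=h(\hat h^{-1}(\phi_1),\hat h^{-1}(\phi_2))$. A (left) hermitian calculus is a triple $(\mathcal A,\mathfrak g,h)$ with $(\mathcal A,\mathfrak g)$ a (left) derivation based calculus and $h$ an invertible left hermitian form on $\Omega^1_{\mathfrak g}$. Symmetry form. For $\partial\in\mathfrak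 g$ let $\varphi(\partial)\in(\Omega^1_{\mathfrak g})^*$ be $\varphi(\partial)(\omega)=\omega(\partial)$. The symmetry form $\rho\in\bar\Omega^2_{\mathfrak g}$ is $\rho(\partial_1,\partial_2)=h^{-1}(\varphi(\partial_1^* ),\varphi(\partial_2))-h^{-1}(\varphi(\partial_2^* ),\varphi(\partial_1))$. The calculus is weakly symmetric if $d\rho=0$. Levi-Civita. A connection $\nabla$ on $\Omega^1_{\mathfrak g}$ is torsion free if $(\nabla_{\partial_1}\omega)(\partial_2)-(\nabla_{\partial_2}\omega)(\partial_1)=d\omega(\partial_1,\partial_2)$ for all $\omega\in\Omega^1_{\mathfrak g}$, $\partial_1,\partial_2\in\mathfrak g$; it is compatible with $h$ if $\partial h(\omega,\eta)=h(\nabla_\partial\omega,\eta)+h(\omega,\nabla_{\partial^*}\eta)$ for all $\omega,\eta\in\Omega^1_{\mathfrak g}$, $\partial\in\mathfrak g$. It is a Levi-Civita connection with respect to $h$ if it is torsion free and compatible with $h$. *)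

(* Defs.v *)
From HB Require Import structures.
From mathcomp Require Import all_boot all_order all_algebra.
From mathcomp Require Import all_classical.

Set Implicit Arguments.
Unset Strict Implicit.
Unset Printing Implicit Defensive.

Import GRing.Theory Num.Theory.
Local Open Scope ring_scope.

HB.mixin Record isStarAlgebra (C : numClosedFieldType) A of GRing.Algebra C A := {
  star : A -> A;
  starK : involutive star;
  starD : forall a b, star (a + b) = star a + star b;
  starZ : forall (k : C) a, star (k *: a) = Num.conj k *: star a;
  starM : forall a b, star (a * b) = star b * star a
}.

#[short(type="starAlgType")]
HB.structure Definition StarAlgebra (C : numClosedFieldType) :=
  {A of GRing.Algebra C A & isStarAlgebra C A}.

Section Derivations.
Variables (C : numClosedFieldType) (A : starAlgType C).

Definition central (z : A) : Prop := forall a, GRing.comm z a.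

Definition derivation (D : A -> A) : Prop :=
  (forall (k : C) a b, D (k *: a + b) = k *: D a + D b) /\
  (forall a b, D (a * b) = D a * b + a * D b).

Definition der_bracket (D1 D2 : A -> A) : A -> A :=
  fun a => D1 (D2 a) - D2 (D1 a).

Definition der_star (D : A -> A) : A -> A := fun a => star (D (star a)).

(* Zero, sums and complex multiples in [A -> A] are the pointwise ones.
   Membership is a boolean predicate, which classically is an arbitrary
   subset of [A -> A]. *)
Record lieSubalgebra := LieSubalgebra {
  lie_pred :> {pred (A -> A)};
  lie_derivation : forall D, D \in lie_pred -> derivation D;
  lie_submod_closed : submod_closed lie_pred;
  lie_bracket_closed : forall D1 D2,
    D1 \in lie_pred -> D2 \in lie_pred -> der_bracket D1 D2 \in lie_pred;
  lie_star_closed : forall D, D \in lie_pred -> der_star D \in lie_pred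
}.

HB.instance Definition _ (g : lieSubalgebra) :=
  GRing.isSubmodClosed.Build C (A -> A) (lie_pred g) (lie_submod_closed g).

Definition lie_elt (g : lieSubalgebra) : Type := {D : A -> A | D \in lie_pred g}.

HB.instance Definition _ g := SubChoice.on (lie_elt g).
HB.instance Definition _ g := [SubChoice_isSubLmodule of lie_elt g by <:].

End Derivations.

Coercion lie_elt : lieSubalgebra >-> Sortclass.

Definition der_fun (C : numClosedFieldType) (A : starAlgType C)
  (g : lieSubalgebra A) (D : g) : A -> A := val D.
Coercion der_fun : lie_elt >-> Funclass.

Lemma der_funD (C : numClosedFieldType) (A : starAlgType C)
  (g : lieSubalgebra A) (D1 D2 : g) a : (D1 + D2 : g) a = D1 a + D2 a.
Proof. by rewrite /der_fun raddfD. Qed.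

Section Forms.
Variables (C : numClosedFieldType) (A : starAlgType C) (g : lieSubalgebra A).
Implicit Types (D : g) (z a b : A) (k : nat).

Definition lie_bracket D1 D2 : g :=
  Sub (der_bracket D1 D2) (lie_bracket_closed (valP D1) (valP D2)).

Definition lie_star D : g := Sub (der_star D) (lie_star_closed (valP D)).

(* [is_zmul z D D'] says that z D is in g, and is the element D'. *)
Definition is_zmul z D D' : Prop := forall a, D' a = z * D a.

(* Left A-module structure (a w)(v) = a w(v): the one of functions with values
   in A viewed as the left module [A^o] over itself. *)
Definition cochain k : Type := k.-tuple g -> A.
HB.instance Definition _ k := GRing.Lmodule.copy (cochain k) (k.-tuple g -> A^o).

Definition tset k (v : k.-tuple g) (i : 'I_k) D : k.-tuple g :=
  [tuple if j == i then D else tnth v j | j < k].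

(* $\bar\Omega^k_g$; for k = 0 the conditions are empty and a 0-form is the
   element of A which it takes as value at the empty tuple. *)
Record Omegabar k (w : cochain k) : Prop := {
  Omegabar_additive : forall v i D1 D2,
    w (tset v i (D1 + D2)) = w (tset v i D1) + w (tset v i D2);
  Omegabar_alternating : forall v i j,
    i != j -> tnth v i = tnth v j -> w v = 0;
  Omegabar_central : forall v (i : 'I_k) z D D', nat_of_ord i = 0%N ->
    central z -> is_zmul z D D' -> w (tset v i D') = z * w (tset v i D)
}.

Definition d0 a : cochain 1 := fun v => thead v a.

Definition omit1 k (v : k.+1.-tuple g) (i : 'I_k.+1) : k.-tuple g :=
  [tuple tnth v (lift i m) | m < k].

(* Meant for i < j: [inord i : 'I_k.+1] is then i seen as a position among the
   entries other than the j-th, so the entries i and j are left out. *)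
Definition omit2 k (v : k.+2.-tuple g) (i j : 'I_k.+2) : k.-tuple g :=
  [tuple tnth v (lift j (lift (inord i : 'I_k.+1) m)) | m < k].

Definition dform k (w : cochain k.+1) : cochain k.+2 := fun v =>
  \sum_(i < k.+2) (-1) ^+ i * (tnth v i) (w (omit1 v i)) +
  \sum_(i < k.+2) \sum_(j < k.+2 | (i < j)%N)
    (-1) ^+ (i + j) *
      w [tuple of lie_bracket (tnth v i) (tnth v j) :: omit2 v i j].

Definition Omega1_pred : {pred cochain 1} := fun w =>
  `[< exists s : seq (A * A), w = \sum_(p <- s) p.1 *: d0 p.2 >].

Lemma Omega1_submod_closed : submod_closed Omega1_pred.
Proof.
split; first by apply/asboolP; exists [::]; rewrite big_nil.
move=> a u v /asboolP[s ->] /asboolP[t ->]; apply/asboolP.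
exists ([seq (a * p.1, p.2) | p <- s] ++ t).
rewrite big_cat big_map scaler_sumr; congr (_ + _).
by apply: eq_bigr => p _; rewrite scalerA.
Qed.

HB.instance Definition _ := GRing.isSubmodClosed.Build A (cochain 1)
  Omega1_pred Omega1_submod_closed.

Definition Omega1 : Type := {w : cochain 1 | w \in Omega1_pred}.
HB.instance Definition _ := SubChoice.on Omega1.
HB.instance Definition _ := [SubChoice_isSubLmodule of Omega1 by <:].

Definition form_of (w : Omega1) : 1.-tuple g -> A := val w.

End Forms.

Coercion form_of : Omega1 >-> Funclass.

Section Omega1Theory.
Variables (C : numClosedFieldType) (A : starAlgType C) (g : lieSubalgebra A).

Lemma Omega1_sub_Omegabar (w : Omega1 g) : Omegabar (form_of w).
Proof.
have [s ws] := asboolP _ (valP w).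
have wE v : w v = \sum_(p <- s) p.1 * thead v p.2.
  by rewrite /form_of ws fct_sumE.
have theadE (v : 1.-tuple g) (i : 'I_1) (D : g) : thead (tset v i D) = D.
  by rewrite /thead tnth_mktuple [i]ord1.
split=> [v i D1 D2|v i j|v i z D D' _ zc zD].
- rewrite !wE -big_split; apply: eq_bigr => p _.
  by rewrite !theadE der_funD mulrDr.
- by rewrite !ord1.
- rewrite !wE mulr_sumr; apply: eq_bigr => p _.
  by rewrite !theadE zD !mulrA zc.
Qed.

(* $\varphi(D)$ *)
Definition eval_at (D : g) (w : Omega1 g) : A := w [tuple D].

Lemma eval_at_scalar (D : g) : scalar (eval_at D).
Proof. by []. Qed.

HB.instance Definition _ (D : g) :=
  GRing.isLinear.Build A (Omega1 g) A *%R (eval_at D) (eval_at_scalar D).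

Definition varphi (D : g) : {scalar Omega1 g} := eval_at D.

Section Connection.
Variables (M : lmodType A) (nabla : M -> g -> M).

Record is_connection : Prop := {
  connectionDl : forall m1 m2 D, nabla (m1 + m2) D = nabla m1 D + nabla m2 D;
  connectionDr : forall m D1 D2, nabla m (D1 + D2) = nabla m D1 + nabla m D2;
  connectionZ : forall a m (D : g), nabla (a *: m) D = a *: nabla m D + D a *: m;
  connection_central : forall z m (D D' : g),
    central z -> is_zmul z D D' -> nabla m D' = z *: nabla m D
}.

End Connection.

End Omega1Theory.

Definition derivation_based_calculus (C : numClosedFieldType)
    (A : starAlgType C) (g : lieSubalgebra A) : Prop :=
  exists nabla : Omega1 g -> g -> Omega1 g, is_connection nabla.

Section HermitianForms.
Variables (C : numClosedFieldType) (A : starAlgType C) (M : lmodType A).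

Record hermitianForm := HermitianForm {
  herm_fun :> M -> M -> A;
  hermDl : forall m1 m2 m, herm_fun (m1 + m2) m = herm_fun m1 m + herm_fun m2 m;
  hermZl : forall a m1 m2, herm_fun (a *: m1) m2 = a * herm_fun m1 m2;
  herm_star : forall m1 m2, star (herm_fun m1 m2) = herm_fun m2 m1
}.

Variable h : hermitianForm.

Definition hat_fun (m1 m2 : M) : A := h m2 m1.

Lemma hat_fun_scalar m : scalar (hat_fun m).
Proof. by move=> a u v; rewrite /hat_fun hermDl hermZl. Qed.

HB.instance Definition _ m :=
  GRing.isLinear.Build A M A *%R (hat_fun m) (hat_fun_scalar m).

Definition hat (m : M) : {scalar M} := hat_fun m.

Definition herm_invertible : Prop := bijective hat.

(* The preimage of phi under [hat], when [hat] is bijective; the default value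
   0 is then irrelevant. *)
Definition hat_inv (phi : {scalar M}) : M := xget 0 [set m | hat m = phi].

Lemma scalar_ext (f1 f2 : {scalar M}) : f1 =1 f2 -> f1 = f2.
Proof.
move=> /funext; case: f1 f2 => f1 [[s1] [a1]] [f2 [[s2] [a2]]] /= e.
subst f2; congr (GRing.Linear.Pack (GRing.Linear.Class _ _)).
- by congr Algebra.isNmodMorphism.phant_Build; exact: Prop_irrelevance.
- by congr GRing.isScalable.phant_Build; exact: Prop_irrelevance.
Qed.

Lemma hat_invK (phi : {scalar M}) : herm_invertible -> hat (hat_inv phi) = phi.
Proof.
case=> f _ fK; rewrite /hat_inv; case: xgetP => [m _ //|/(_ (f phi)) /=].
by rewrite fK.
Qed.

Lemma hat_inv_eq (phi : {scalar M}) m :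
  herm_invertible -> hat m =1 phi -> hat_inv phi = m.
Proof.
by move=> hV /scalar_ext e; apply: (bij_inj hV); rewrite hat_invK.
Qed.

Lemma hermDr m m1 m2 : h m (m1 + m2) = h m m1 + h m m2.
Proof. by rewrite -herm_star hermDl starD !herm_star. Qed.

Lemma hermZr a m1 m2 : h m1 (a *: m2) = h m1 m2 * star a.
Proof. by rewrite -herm_star hermZl starM herm_star. Qed.

Definition herm_inv (phi1 phi2 : {scalar M}) : A := h (hat_inv phi1) (hat_inv phi2).

End HermitianForms.

Section HermitianCalculus.
Variables (C : numClosedFieldType) (A : starAlgType C) (g : lieSubalgebra A).
Variable h : hermitianForm (Omega1 g).

Definition hermitian_calculus : Prop :=
  derivation_based_calculus g /\ herm_invertible h.

Definition symmetry_form : cochain g 2 := fun v =>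
  let D1 := tnth v ord0 in let D2 := tnth v ord_max in
  herm_inv h (varphi (lie_star D1)) (varphi D2) -
  herm_inv h (varphi (lie_star D2)) (varphi D1).

Let m_ D := hat_inv h (varphi D).

Lemma symmetry_form_Omegabar : herm_invertible h -> Omegabar symmetry_form.
Proof.
move=> hV.
have lie_ext (D D' : g) : (forall a, D a = D' a) -> D = D'.
  by move=> e; apply/val_inj/funext.
have mE D w : h w (m_ D) = varphi D w by rewrite -(hat_invK (varphi D) hV).
have mP D m : (forall w : Omega1 g, h w m = w [tuple D]) -> m_ D = m.
  by move=> e; exact: hat_inv_eq.
have wD (w : Omega1 g) D1 D2 : w [tuple D1 + D2] = w [tuple D1] + w [tuple D2].
  have /= := Omegabar_additive (Omega1_sub_Omegabar w) [tuple D1] ord0 D1 D2.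
  rewrite (_ : tset _ _ _ = [tuple D1 + D2]); last first.
    by apply/eq_from_tnth => i; rewrite tnth_mktuple !ord1.
  rewrite (_ : tset _ _ D1 = [tuple D1]); last first.
    by apply/eq_from_tnth => i; rewrite tnth_mktuple !ord1.
  rewrite (_ : tset _ _ D2 = [tuple D2])//.
  by apply/eq_from_tnth => i; rewrite tnth_mktuple !ord1.
have wZ (w : Omega1 g) z D D' : central z -> is_zmul z D D' ->
    w [tuple D'] = z * w [tuple D].
  move=> zc zD.
  have /= := Omegabar_central (Omega1_sub_Omegabar w) [tuple D]
    (erefl : nat_of_ord (ord0 : 'I_1) = 0%N) zc zD.
  rewrite (_ : tset _ _ D' = [tuple D']); last first.
    by apply/eq_from_tnth => i; rewrite tnth_mktuple !ord1.
  rewrite (_ : tset _ _ D = [tuple D])//.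
  by apply/eq_from_tnth => i; rewrite tnth_mktuple !ord1.
have mD D1 D2 : m_ (D1 + D2) = m_ D1 + m_ D2.
  by apply: mP => w; rewrite hermDr !mE wD.
have mZ z D D' : central z -> is_zmul z D D' -> m_ D' = star z *: m_ D.
  by move=> zc zD; apply: mP => w; rewrite hermZr starK mE (wZ _ _ _ _ zc zD) zc.
have starDD (D1 D2 : g) : lie_star (D1 + D2) = lie_star D1 + lie_star D2.
  apply: lie_ext => a; rewrite der_funD.
  change (star ((D1 + D2 : g) (star a)) =
    star (D1 (star a)) + star (D2 (star a))).
  by rewrite der_funD starD.
have starDZ z (D D' : g) : central z -> is_zmul z D D' ->
    is_zmul (star z) (lie_star D) (lie_star D').
  move=> zc zD a.
  change (star (D' (star a)) = star z * star (D (star a))).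
  by rewrite zD zc starM.
have starc (z : A) : central z -> central (star z).
  by move=> zc a; rewrite /GRing.comm -[a]starK -!starM zc.
have ordP (i : 'I_2) : i = ord0 \/ i = ord_max.
  by case: i => [[|[]]]//= ?; [left|right]; exact: val_inj.
have e10 : (ord_max == ord0 :> 'I_2) = false by [].
have e01 : (ord0 == ord_max :> 'I_2) = false by [].
rewrite /symmetry_form; split.
- move=> v i D1 D2; case: (ordP i) => ->; rewrite !tnth_mktuple ?eqxx ?e10 ?e01
    /herm_inv -!/(m_ _) starDD !mD hermDl hermDr opprD; by rewrite addrACA.
- move=> v i j; case: (ordP i) (ordP j) => -> [] -> //= _ ->; exact: subrr.
- move=> v i z D D' i0 zc zD; have -> : i = ord0 by exact: val_inj.
  rewrite !tnth_mktuple eqxx e10 /herm_inv -!/(m_ _) mulrBr.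
  rewrite (mZ _ _ _ (starc z zc) (starDZ _ _ _ zc zD)) starK hermZl.
  by rewrite (mZ _ _ _ zc zD) hermZr starK -zc.
Qed.

Definition weakly_symmetric : Prop := dform symmetry_form = 0.

Definition torsion_free (nabla : Omega1 g -> g -> Omega1 g) : Prop :=
  forall (w : Omega1 g) (D1 D2 : g),
    nabla w D1 [tuple D2] - nabla w D2 [tuple D1] = dform (form_of w) [tuple D1; D2].

Definition compatible (nabla : Omega1 g -> g -> Omega1 g) : Prop :=
  forall (w eta : Omega1 g) (D : g),
    D (h w eta) = h (nabla w D) eta + h w (nabla eta (lie_star D)).

Record levi_civita (nabla : Omega1 g -> g -> Omega1 g) : Prop := {
  levi_civita_connection : is_connection nabla;
  levi_civita_torsion_free : torsion_free nabla;
  levi_civita_compatible : compatible nabla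
}.

End HermitianCalculus.

(* Main.v *)
Require Import Defs.
From mathcomp Require Import all_boot all_order all_algebra.
From mathcomp Require Import all_classical reals complex.

(** Write [flat D] for the 1-form with [h w (flat D) = w(D^* )], so that
    [rho(D, E) = flat D (E) - flat E (D)].  Let
    [U D E F = h (flat E, nabla_{D^*} (flat F^* ))].  Compatibility says
    [D (flat E (F)) = (nabla_D (flat E)) (F) + U D E F], so vanishing torsion gives
    [U D E F - U F E D = flat E ([D, F])], and the conjugate of vanishing torsion
    gives [U D E F - U E D F = D (flat E (F)) - E (flat D (F)) - flat [D, E] (F)].
    Substituting both in [d rho], all terms cancel in pairs. *)

Import GRing.Theory.
Local Open Scope ring_scope.

Section DformLowDegree.
Variables (C : numClosedFieldType) (A : starAlgType C) (g : lieSubalgebra A).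

Lemma lie_funB (D : g) a b : D (a - b) = D a - D b.
Proof.
have [DL _] := lie_derivation (valP D).
by rewrite addrC -scaleN1r /der_fun DL scaleN1r addrC.
Qed.

Lemma lie_starK (D : g) : lie_star (lie_star D) = D.
Proof.
apply/val_inj/funext => a; change (star (star (D (star (star a)))) = D a).
by rewrite !starK.
Qed.

Lemma lie_star_fun (D : g) a : star (lie_star D a) = D (star a).
Proof. exact: starK. Qed.

Lemma starB (a b : A) : star (a - b) = star a - star b.
Proof. by apply/eqP; rewrite eq_sym subr_eq -starD subrK. Qed.

Lemma lie_bracket_star (D E : g) :
  lie_bracket (lie_star D) (lie_star E) = lie_star (lie_bracket D E).
Proof.
apply/val_inj/funext => a.
change (star (D (star (star (E (star a))))) - star (E (star (star (D (star a)))))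
        = star (D (E (star a)) - E (D (star a)))).
by rewrite starB !starK.
Qed.

Lemma tuple1P (u : 1.-tuple g) D : tnth u ord0 = D -> u = [tuple D].
Proof. by move=> uD; apply/eq_from_tnth => i; rewrite ord1. Qed.

Lemma tuple2P (u : 2.-tuple g) D E :
  tnth u ord0 = D -> tnth u (lift ord0 ord0) = E -> u = [tuple D; E].
Proof.
move=> uD uE; apply/eq_from_tnth => -[[|[|//]] i].
  by rewrite (_ : Ordinal i = ord0) //; exact: val_inj.
by rewrite (_ : Ordinal i = lift ord0 ord0) //; exact: val_inj.
Qed.

Lemma dform1E (w : cochain g 1) D E :
  dform w [tuple D; E] =
  D (w [tuple E]) - E (w [tuple D]) - w [tuple lie_bracket D E].
Proof.
rewrite /dform.
(* The condition [i < j] moves into the summand, so that both sums unfold term by term and each test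
   computes. *)
under [X in _ + X]eq_bigr => i _ do rewrite big_mkcond.
rewrite !big_ord_recl !big_ord0 /=.
rewrite !expr0 !mul1r !addr0 !add0r !expr1 !mulN1r.
by congr (_ - _ - _); [congr (D (w _))|congr (E (w _))|congr (w _)];
  apply: tuple1P; rewrite ?tnth_mktuple.
Qed.

Lemma dform2E (w : cochain g 2) D E F :
  dform w [tuple D; E; F] =
  D (w [tuple E; F]) - E (w [tuple D; F]) + F (w [tuple D; E])
  - w [tuple lie_bracket D E; F] + w [tuple lie_bracket D F; E]
  - w [tuple lie_bracket E F; D].
Proof.
(* [inord] does not reduce by computation, so the double omissions are settled beforehand, through
   the position [k] of the one surviving entry. *)
have omitE (i j k : 'I_3) : lift j (lift (inord i : 'I_2) ord0) = k ->
    omit2 [tuple D; E; F] i j = [tuple tnth [tuple D; E; F] k].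
  by move=> <-; apply: tuple1P; rewrite tnth_mktuple.
pose o1 : 'I_3 := lift ord0 ord0; pose o2 : 'I_3 := lift ord0 (lift ord0 ord0).
have omit01 : omit2 [tuple D; E; F] ord0 o1 = [tuple F].
  by apply: (omitE _ _ o2); apply: val_inj; rewrite /= /bump inordK.
have omit02 : omit2 [tuple D; E; F] ord0 o2 = [tuple E].
  by apply: (omitE _ _ o1); apply: val_inj; rewrite /= /bump inordK.
have omit12 : omit2 [tuple D; E; F] o1 o2 = [tuple D].
  by apply: (omitE _ _ ord0); apply: val_inj; rewrite /= /bump inordK.
rewrite /dform.
under [X in _ + X]eq_bigr => i _ do rewrite big_mkcond.
rewrite !big_ord_recl !big_ord0.
have skip0 : omit1 [tuple D; E; F] ord0 = [tuple E; F].
  by apply: tuple2P; rewrite tnth_mktuple.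
have skip1 : omit1 [tuple D; E; F] o1 = [tuple D; F].
  by apply: tuple2P; rewrite tnth_mktuple.
have skip2 : omit1 [tuple D; E; F] o2 = [tuple D; E].
  by apply: tuple2P; rewrite tnth_mktuple.
rewrite omit01 omit02 omit12 skip0 skip1 skip2 /=.
rewrite -[bump 0 (bump 0 0)]/2%N -[bump 0 0]/1%N -[(1 + 2)%N]/3%N !add0n.
rewrite expr0 expr1 [_ ^+ 3]exprS sqrrN expr1n mulr1 !mul1r !mulN1r !addr0 !add0r.
by rewrite !addrA.
Qed.

End DformLowDegree.

Section LeviCivita.
Variables (C : numClosedFieldType) (A : starAlgType C) (g : lieSubalgebra A).
Variables (h : hermitianForm (Omega1 g)) (hV : herm_invertible h).

(** The star undoes the conjugate-linearity of [h] in its second argument: [flat] commutes with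
    central factors that stay in [g]. *)
Definition flat (D : g) : Omega1 g := hat_inv h (varphi (lie_star D)).

Lemma herm_flatr (w : Omega1 g) D : h w (flat D) = w [tuple lie_star D].
Proof.
change (hat h (hat_inv h (varphi (lie_star D))) w = varphi (lie_star D) w).
by rewrite hat_invK.
Qed.

Lemma star_flat D E :
  star (flat D [tuple E]) = flat (lie_star E) [tuple lie_star D].
Proof. by rewrite -herm_flatr -herm_star herm_flatr lie_starK. Qed.

Lemma symmetry_formE D E :
  symmetry_form h [tuple D; E] = flat D [tuple E] - flat E [tuple D].
Proof.
have herm_invE (D1 D2 : g) :
    herm_inv h (varphi (lie_star D1)) (varphi D2) = flat D1 [tuple D2].
  by rewrite -{1}[D2](lie_starK _ _ _ D2) /herm_inv herm_flatr lie_starK.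
by congr (_ - _); apply: herm_invE.
Qed.

Variables (nabla : Omega1 g -> g -> Omega1 g) (hLC : levi_civita h nabla).

Let U (D E F : g) : A := h (flat E) (nabla (flat (lie_star F)) (lie_star D)).

Lemma flat_compatible (D E F : g) :
  D (flat E [tuple F]) = nabla (flat E) D [tuple F] + U D E F.
Proof.
have := levi_civita_compatible hLC (flat E) (flat (lie_star F)) D.
by rewrite !herm_flatr lie_starK.
Qed.

(** In the torsion identity for [flat E] at [D], [F], compatibility replaces both derivative terms;
    the values of [nabla (flat E)] then cancel and only [U] remains. *)
Lemma flat_torsion (D E F : g) :
  flat E [tuple lie_bracket D F] = U D E F - U F E D.
Proof.
have := levi_civita_torsion_free hLC (flat E) D F.
rewrite dform1E !flat_compatible opprD addrACA.
by move=> /esym/eqP; rewrite subr_eq => /eqP /addrI.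
Qed.

Lemma star_flat_torsion (D E F : g) :
  D (flat E [tuple F]) - E (flat D [tuple F]) - flat (lie_bracket D E) [tuple F]
  = U D E F - U E D F.
Proof.
rewrite /U -![h (flat _) _]herm_star !herm_flatr -starB.
rewrite (levi_civita_torsion_free hLC) dform1E !starB !lie_star_fun.
by rewrite lie_bracket_star !star_flat !lie_starK.
Qed.

Lemma levi_civita_weakly_symmetric : weakly_symmetric h.
Proof.
apply/funext => v.
have -> : v = [tuple thead v; tnth v (lift ord0 ord0); tnth v ord_max].
  apply/eq_from_tnth => -[[|[|[|//]]] i];
    rewrite [RHS](tnth_nth (thead v)) /=; congr tnth; exact: val_inj.
move: (thead v) (tnth v ord_max) (tnth v _) => D F E.
rewrite dform2E !symmetry_formE !lie_funB !opprB !addrA.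
(* The first three groups are [star_flat_torsion] at [(D, E, F)], at [(E, F, D)] and, with opposite
   sign, at [(D, F, E)]; the last three terms are left for [flat_torsion]. *)
rewrite [LHS](ACl ((1*4*8)*(3*6*12)*(9*(5*2))*7*10*11))/=.
rewrite !star_flat_torsion.
have -> : flat (lie_bracket D F) [tuple E]
    + (F (flat D [tuple E]) - D (flat F [tuple E])) = U F D E - U D F E.
  by rewrite -[RHS]opprB -star_flat_torsion !opprB.
rewrite !flat_torsion !opprB !addrA.
(* Each of the six orderings of [D], [E], [F] in [U] now occurs twice, with opposite signs. *)
rewrite [LHS](ACl ((1*10)*(11*2)*(3*8)*(9*4)*(5*12)*(7*6)))/=.
by rewrite !subrr !addr0.
Qed.

End LeviCivita.

Theorem proposition7p4 (R : realType) (A : starAlgType R[i])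
    (g : lieSubalgebra A) (h : hermitianForm (Omega1 g))
    (hcalc : hermitian_calculus h)
    (hLC : exists nabla : Omega1 g -> g -> Omega1 g, levi_civita h nabla) :
  weakly_symmetric h.
Proof.
by case: hcalc hLC => _ hV [nabla]; apply: levi_civita_weakly_symmetric.
Qed.
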